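(* Let $\mathsf{LJpm}$ be the multi-succedent sequent calculus for intuitionistic propositional logic described in the context. Then: (1) every intuitionistically valid sequent $\Gamma\Rightarrow\Delta$ is derivable in $\mathsf{LJpm}$ (completeness with respect to Kripke semantics); and (2) $\mathsf{LJpm}$ admits the Hauptsatz, i.e. the cut rule $$\frac{\Gamma\Rightarrow\alpha,\Delta\qquad \Gamma,\alpha\Rightarrow\Delta}{\Gamma\Rightarrow\Delta}$$ is admissible: if both premises are derivable in $\mathsf{LJpm}$, so is the conclusion.
   Context: Formulas are built from propositional variables (atoms) $p,q,r,\dots$ and $\bot$ using $\lor,\land,\supset$; $Atm$ is the set of atoms. Cedents are finite sets of formulas; a sequent is a pair $\Gamma\Rightarrow\Delta$ of cedents. The calculus $\mathsf{LJpm}$ has axioms: $\Gamma\Rightarrow\Delta$ whenever $\Gamma\cap\Delta\cap Atm\neq\emptyset$, and $\Gamma\Rightarrow\Delta$ whenever $\bot\in\Gamma$. Its inference rules (the principal formula stays in the lower sequent and is retained in the premises): $(\lor\Rightarrow)$: from $\alpha_0,\Gamma\Rightarrow\Delta$ and $\alpha_1,\Gamma\Rightarrow\Delta$ infer $\Gamma\Rightarrow\Delta$, where $\alpha_0\lor\alpha_1\in\Gamma$; $(\Rightarrow\lor)$: from $\Delta\Rightarrow\Gamma,\alpha_0,\alpha_1$ infer $\Delta\Rightarrow\Gamma$, where $\alpha_0\lor\alpha_1\in\Gamma$; $(\land\Rightarrow)$: from $\alpha_0,\alpha_1,\Gamma\Rightarrow\Delta$ infer $\Gamma\Rightarrow\Delta$,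 where $\alpha_0\land\alpha_1\in\Gamma$; $(\Rightarrow\land)$: from $\Delta\Rightarrow\Gamma,\alpha_0$ and $\Delta\Rightarrow\Gamma,\alpha_1$ infer $\Delta\Rightarrow\Gamma$, where $\alpha_0\land\alpha_1\in\Gamma$; $(\supset\Rightarrow)$: from $\Gamma\Rightarrow\Delta,\alpha$ and $\beta,\Gamma\Rightarrow\Delta$ infer $\Gamma\Rightarrow\Delta$, where $\alpha\supset\beta\in\Gamma$; $(\Rightarrow\supset)$: from $\alpha,\Delta\Rightarrow\beta$ infer $\Delta\Rightarrow\Gamma$, where $\alpha\supset\beta\in\Gamma$ (the succedent of the premise is the single formula $\beta$). Derivations are finite trees built from these rules whose leaves are axioms; there is no cut rule in $\mathsf{LJpm}$. A Kripke model is $\langle W,\preceq,V\rangle$ with $W\neq\emptyset$, $\preceq$ a reflexive transitive relation on $W$, and $V:W\to\mathcal P(Atm)$ with $V(\sigma)\subseteq V(\tau)$ whenever $\sigma\preceq\tau$. Forcing: $\sigma\models p$ iff $p\in V(\sigma)$; $\sigma\not\models\bot$; $\lor,\land$ pointwise; $\sigma\models\alpha\supset\beta$ iff for all $\tau\succeq\sigma$, $\tau\models\alpha$ implies $\tau\models\beta$. A sequent $\Gamma\Rightarrow\Delta$ is intuitionistically valid if for every Kripke model and every world $\sigma$, $\sigma\models\bigwedge\Gamma$ implies $\sigma\models\bigvee\Delta$. *)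

(* Defs.v *)
From HB Require Import structures.
From mathcomp Require Import all_boot finmap.

Set Implicit Arguments.
Unset Strict Implicit.
Unset Printing Implicit Defensive.

Local Open Scope fset_scope.

Inductive form (Atm : Type) : Type :=
  | Atom of Atm
  | Bot
  | Or of form Atm & form Atm
  | And of form Atm & form Atm
  | Imp of form Atm & form Atm.

Arguments Bot {Atm}.

(* An encoding of formulas as generic trees, used only to equip them with the
   decidable equality and choice operator required to form {fset form Atm}. *)
Fixpoint tree_of_form (Atm : Type) (a : form Atm) : GenTree.tree Atm :=
  match a with
  | Atom p => GenTree.Leaf p
  | Bot => GenTree.Node 0 [::]
  | Or a0 a1 => GenTree.Node 1 [:: tree_of_form a0; tree_of_form a1]
  | And a0 a1 => GenTree.Node 2 [:: tree_of_form a0; tree_of_form a1]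
  | Imp a0 a1 => GenTree.Node 3 [:: tree_of_form a0; tree_of_form a1]
  end.

Fixpoint form_of_tree (Atm : Type) (t : GenTree.tree Atm) :
    option (form Atm) :=
  match t with
  | GenTree.Leaf p => Some (Atom p)
  | GenTree.Node 0 [::] => Some Bot
  | GenTree.Node n [:: t0; t1] =>
      match n, form_of_tree t0, form_of_tree t1 with
      | 1, Some a0, Some a1 => Some (Or a0 a1)
      | 2, Some a0, Some a1 => Some (And a0 a1)
      | 3, Some a0, Some a1 => Some (Imp a0 a1)
      | _, _, _ => None
      end
  | _ => None
  end.

Lemma tree_of_formK (Atm : Type) :
  pcancel (@tree_of_form Atm) (@form_of_tree Atm).
Proof. by elim=> [p||a IHa b IHb|a IHa b IHb|a IHa b IHb] //=; rewrite IHa IHb. Qed.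

HB.instance Definition _ (Atm : eqType) :=
  Equality.copy (form Atm) (pcan_type (@tree_of_formK Atm)).
HB.instance Definition _ (Atm : choiceType) :=
  Choice.copy (form Atm) (pcan_type (@tree_of_formK Atm)).

(* [LJpm G D] : the sequent G => D has a derivation. In every rule the
   principal formula belongs to the lower sequent and stays in the premises,
   except for the succedent of the premise of [LJpm_impR]. *)
Inductive LJpm (Atm : choiceType) :
    {fset form Atm} -> {fset form Atm} -> Prop :=
  | LJpm_ax (G D : {fset form Atm}) (p : Atm) :
      Atom p \in G -> Atom p \in D -> LJpm G D
  | LJpm_botL (G D : {fset form Atm}) :
      Bot \in G -> LJpm G D
  | LJpm_orL (G D : {fset form Atm}) (a0 a1 : form Atm) :
      Or a0 a1 \in G -> LJpm (a0 |` G) D -> LJpm (a1 |` G) D -> LJpm G D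
  | LJpm_orR (D G : {fset form Atm}) (a0 a1 : form Atm) :
      Or a0 a1 \in G -> LJpm D (a0 |` (a1 |` G)) -> LJpm D G
  | LJpm_andL (G D : {fset form Atm}) (a0 a1 : form Atm) :
      And a0 a1 \in G -> LJpm (a0 |` (a1 |` G)) D -> LJpm G D
  | LJpm_andR (D G : {fset form Atm}) (a0 a1 : form Atm) :
      And a0 a1 \in G -> LJpm D (a0 |` G) -> LJpm D (a1 |` G) -> LJpm D G
  | LJpm_impL (G D : {fset form Atm}) (a b : form Atm) :
      Imp a b \in G -> LJpm G (a |` D) -> LJpm (b |` G) D -> LJpm G D
  | LJpm_impR (D G : {fset form Atm}) (a b : form Atm) :
      Imp a b \in G -> LJpm (a |` D) [fset b] -> LJpm D G.

Record kripke_model (Atm : Type) := KripkeModel {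
  world : Type;
  world_inh : inhabited world;
  acc : world -> world -> Prop;
  acc_refl : forall s, acc s s;
  acc_trans : forall s t u, acc s t -> acc t u -> acc s u;
  val_at : world -> Atm -> Prop;
  val_mono : forall s t, acc s t -> forall p, val_at s p -> val_at t p }.

Fixpoint forces (Atm : Type) (M : kripke_model Atm) (s : world M)
    (a : form Atm) : Prop :=
  match a with
  | Atom p => val_at s p
  | Bot => False
  | Or a0 a1 => forces s a0 \/ forces s a1
  | And a0 a1 => forces s a0 /\ forces s a1
  | Imp a0 a1 => forall t : world M, acc s t -> forces t a0 -> forces t a1
  end.

(* The conjunction of the empty cedent is true, its disjunction is false. *)
Definition forces_conj (Atm : choiceType) (M : kripke_model Atm)
    (s : world M) (G : {fset form Atm}) : Prop :=
  forall a, a \in G -> forces s a.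

Definition forces_disj (Atm : choiceType) (M : kripke_model Atm)
    (s : world M) (D : {fset form Atm}) : Prop :=
  exists2 a, a \in D & forces s a.

Definition int_valid (Atm : choiceType) (G D : {fset form Atm}) : Prop :=
  forall (M : kripke_model Atm) (s : world M),
    forces_conj s G -> forces_disj s D.

(* Main.v *)
Require Import Defs.
From HB Require Import structures.
From mathcomp Require Import all_boot finmap.
From Stdlib Require Import Classical.

Local Open Scope fset_scope.

(** Completeness: within the finite set [U] of subformulas of an underivable
    sequent, take as worlds the pairs of subsets of [U] that are maximal among
    the underivable ones, ordered by inclusion of antecedents. Read bottom-up,
    the rules of [LJpm] say that such a world forces its antecedent and refutes
    its succedent. Since [LJpm], and the cut rule as well, are sound for Kripke
    models, completeness makes cut admissible. *)

(** * Finite sets closed under subformulas *)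

Fixpoint subforms {Atm : choiceType} (a : form Atm) : {fset form Atm} :=
  a |` match a with
       | Atom _ | Bot => fset0
       | Or b c | And b c | Imp b c => subforms b `|` subforms c
       end.

Definition subform_closed {Atm : choiceType} (U : {fset form Atm}) : Prop :=
  forall a, a \in U -> subforms a `<=` U.

Lemma subforms_refl (Atm : choiceType) (a : form Atm) : a \in subforms a.
Proof. by case: a => *; rewrite fset1U1. Qed.

Lemma subforms_closed (Atm : choiceType) (a : form Atm) :
  subform_closed (subforms a).
Proof.
(* One induction step serves every constructor: atoms and [Bot] fit the shape with [A] and [B] both
   empty. *)
have step (c : form Atm) A B : subforms c = c |` (A `|` B) ->
    subform_closed A -> subform_closed B -> subform_closed (subforms c).
  move=> cE clA clB x; rewrite cE !inE => /or3P[/eqP->|/clA|/clB].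
  - by rewrite cE.
  - by move/fsubset_trans; apply; rewrite fsetUCA fsubsetUl.
  - by move/fsubset_trans; apply; rewrite fsetUA fsubsetUr.
have cl0 : subform_closed (fset0 : {fset form Atm}) by [].
elim: a => [p||a IHa b IHb|a IHa b IHb|a IHa b IHb];
  [ apply: (step _ _ _ _ cl0 cl0) | apply: (step _ _ _ _ cl0 cl0)
  | apply: (step _ _ _ _ IHa IHb) .. ]; by rewrite /= ?fsetUid.
Qed.

Lemma subform_closed_cover (Atm : choiceType) (G : {fset form Atm}) :
  exists2 U, subform_closed U & G `<=` U.
Proof.
exists (\bigcup_(a <- G) subforms a) => [a /bigfcupP[b bG ab]|].
  apply: fsubset_trans (subforms_closed _ _ _ ab) _.
  by move: bG; rewrite andbT => bG; apply: bigfcup_sup.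
apply/fsubsetP => a aG; apply/bigfcupP; exists a; first by rewrite aG.
exact: subforms_refl.
Qed.

Lemma subform_closed_sub2 (Atm : choiceType) (U : {fset form Atm})
    (a b c : form Atm) :
  subform_closed U -> c \in U -> c \in [:: Or a b; And a b; Imp a b] ->
  (a \in U) * (b \in U).
Proof.
move=> clU cU; rewrite !inE => /or3P[] /eqP cE; subst c;
by have /fsubsetP sU := clU _ cU; split; apply: sU;
  rewrite /= !inE subforms_refl ?orbT.
Qed.

(** Nothing asks that [G] and [D] exhaust [U]: showing this directly would call for cut. *)
Record saturated {Atm : choiceType} (U G D : {fset form Atm}) : Prop :=
  Saturated {
    saturated_subL : G `<=` U;
    saturated_subR : D `<=` U;
    saturated_underivable : ~ LJpm G D;
    saturated_max : forall G' D' : {fset form Atm},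
      G `<=` G' -> D `<=` D' -> G' `<=` U -> D' `<=` U -> ~ LJpm G' D' ->
      G' `<=` G /\ D' `<=` D }.

(** Induction on the room left in [U]: either some underivable pair above has larger total
    cardinality, or the pair at hand is already maximal. *)
Lemma saturated_extension {Atm : choiceType} {U G D : {fset form Atm}} :
  G `<=` U -> D `<=` U -> ~ LJpm G D ->
  exists G' D' : {fset form Atm},
    [/\ saturated U G' D', G `<=` G' & D `<=` D'].
Proof.
have [n] := ubnP (#|`U| + #|`U| - (#|`G| + #|`D|)).
elim: n G D => // n IHn G D; rewrite ltnS => leUn GU DU nGD.
have [[G' [D' [[GG' DD' G'U D'U] [nGD' lt']]]]|maxGD] :=
  classic (exists G' D' : {fset form Atm},
    [/\ G `<=` G', D `<=` D', G' `<=` U & D' `<=` U] /\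
    (~ LJpm G' D' /\ #|`G| + #|`D| < #|`G'| + #|`D'|)).
  have [|G2 [D2 [sat2 G'2 D'2]]] := IHn _ _ _ G'U D'U nGD'.
    apply: leq_trans leUn; apply: ltn_sub2l (lt').
    apply: leq_trans lt' _; apply: leq_add; exact: fsubset_leq_card.
  by exists G2, D2; split=> //; [apply: fsubset_trans G'2|apply: fsubset_trans D'2].
exists G, D; split=> //; split=> // G' D' GG' DD' G'U D'U nGD'.
have := fsubset_leq_card GG'; have := fsubset_leq_card DD' => leD leG.
(* Both inclusions hold and the total size cannot grow, so neither component grows. *)
have le' : #|`G'| + #|`D'| <= #|`G| + #|`D|.
  by rewrite leqNgt; apply/negP => lt'; apply: maxGD; exists G', D'.
have leG' : #|`G'| <= #|`G|.
  by rewrite -(leq_add2r #|`D|) (leq_trans _ le') // leq_add2l.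
have leD' : #|`D'| <= #|`D|.
  by rewrite -(leq_add2l #|`G|) (leq_trans _ le') // leq_add2r.
have /eqP-> : G == G' by rewrite eqEfcard GG'.
by have /eqP-> : D == D' by rewrite eqEfcard DD'.
Qed.

Section Saturated.
Context {Atm : choiceType} {U G D : {fset form Atm}}.
Hypothesis sat : saturated U G D.

(** A whole set [X] is added, since the premise of [LJpm_andL] (dually [LJpm_orR]) gains two
    formulas at once. *)
Lemma saturated_addL (X : {fset form Atm}) :
  X `<=` U -> ~ LJpm (X `|` G) D -> X `<=` G.
Proof.
move=> XU nd; have [GU DU _ satmax] := sat.
have [] := satmax (X `|` G) D; rewrite ?fsubsetUr ?fsubUset ?XU //.
by move=> /andP[].
Qed.

Lemma saturated_addR (X : {fset form Atm}) :
  X `<=` U -> ~ LJpm G (X `|` D) -> X `<=` D.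
Proof.
move=> XU nd; have [GU DU _ satmax] := sat.
have [] := satmax G (X `|` D); rewrite ?fsubsetUr ?fsubUset ?XU //.
by move=> _ /andP[].
Qed.

Hypothesis clU : subform_closed U.

Let memU (a b c : form Atm) :
  c \in G `|` D -> c \in [:: Or a b; And a b; Imp a b] ->
  (a \in U) * (b \in U).
Proof.
move=> cGD; apply: subform_closed_sub2 => //.
have [/fsubsetP GU /fsubsetP DU _ _] := sat.
by move: cGD; rewrite !inE => /orP[/GU|/DU].
Qed.

(** If both disjuncts were missing, maximality would make both premises of [LJpm_orL] derivable. The
    other two-premise rules are read the same way. *)
Lemma saturated_orL (a b : form Atm) : Or a b \in G -> a \in G \/ b \in G.
Proof.
move=> abG; have [] := memU a b (Or a b); rewrite ?inE ?abG ?eqxx // => aU bU.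
apply: NNPP => /not_or_and[naG nbG]; apply: (saturated_underivable _ _ _ sat).
by apply: (LJpm_orL abG); apply: NNPP => nd;
  [apply: naG|apply: nbG]; rewrite -fsub1set saturated_addL ?fsub1set.
Qed.

(** The single premise inherits underivability, so maximality has already absorbed both
    disjuncts. *)
Lemma saturated_orR (a b : form Atm) : Or a b \in D -> a \in D /\ b \in D.
Proof.
move=> abD; have [] := memU a b (Or a b); rewrite ?inE ?abD ?eqxx ?orbT // => aU bU.
apply/andP; rewrite -!fsub1set -fsubUset saturated_addR //.
  by rewrite fsubUset !fsub1set aU.
rewrite -fsetUA => /(LJpm_orR abD).
exact: (saturated_underivable _ _ _ sat).
Qed.

Lemma saturated_andL (a b : form Atm) : And a b \in G -> a \in G /\ b \in G.
Proof.
move=> abG; have [] := memU a b (And a b); rewrite ?inE ?abG ?eqxx ?orbT // => aU bU.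
apply/andP; rewrite -!fsub1set -fsubUset saturated_addL //.
  by rewrite fsubUset !fsub1set aU.
rewrite -fsetUA => /(LJpm_andL abG).
exact: (saturated_underivable _ _ _ sat).
Qed.

Lemma saturated_andR (a b : form Atm) : And a b \in D -> a \in D \/ b \in D.
Proof.
move=> abD; have [] := memU a b (And a b); rewrite ?inE ?abD ?eqxx ?orbT // => aU bU.
apply: NNPP => /not_or_and[naD nbD]; apply: (saturated_underivable _ _ _ sat).
by apply: (LJpm_andR abD); apply: NNPP => nd;
  [apply: naD|apply: nbD]; rewrite -fsub1set saturated_addR ?fsub1set.
Qed.

Lemma saturated_impL (a b : form Atm) : Imp a b \in G -> a \in D \/ b \in G.
Proof.
move=> abG; have [] := memU a b (Imp a b); rewrite ?inE ?abG ?eqxx ?orbT // => aU bU.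
apply: NNPP => /not_or_and[naD nbG]; apply: (saturated_underivable _ _ _ sat).
apply: (LJpm_impL abG); apply: NNPP => nd.
  by apply: naD; rewrite -fsub1set saturated_addR ?fsub1set.
by apply: nbG; rewrite -fsub1set saturated_addL ?fsub1set.
Qed.

(** The premise discards the old succedent, so maximality of the present pair is of no help; the
    premise is saturated afresh, which yields an accessible world. *)
Lemma saturated_impR (a b : form Atm) : Imp a b \in D ->
  exists G' D' : {fset form Atm},
    [/\ saturated U G' D', G `<=` G', a \in G' & b \in D'].
Proof.
move=> abD; have [] := memU a b (Imp a b); rewrite ?inE ?abD ?eqxx ?orbT // => aU bU.
have [||/(LJpm_impR abD)|G' [D' [sat']]] :=
  @saturated_extension Atm U (a |` G) [fset b].
- by rewrite fsubUset fsub1set aU; case: sat.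
- by rewrite fsub1set.
- exact: (saturated_underivable _ _ _ sat).
- by rewrite fsubUset !fsub1set => /andP[aG' GG'] bD'; exists G', D'.
Qed.

End Saturated.

Section CanonicalModel.
Context {Atm : choiceType} {U G0 D0 : {fset form Atm}}.
Hypothesis clU : subform_closed U.
Hypothesis sat0 : saturated U G0 D0.

Definition canonical_world : Type :=
  {w : {fset form Atm} * {fset form Atm} | saturated U w.1 w.2}.

Definition canonical_model : kripke_model Atm.
Proof.
refine (@KripkeModel Atm canonical_world _
  (fun v w => (sval v).1 `<=` (sval w).1) _ _ (fun w p => Atom p \in (sval w).1) _).
(* [sat0] provides the required world. *)
- by constructor; exists (G0, D0).
- by move=> w; apply: fsubset_refl.
- by move=> u v w; apply: fsubset_trans.
- by move=> v w /fsubsetP vw p; apply: vw.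
Defined.

(** Truth lemma. Both halves go through one induction because implication swaps sides, and [w] stays
    general because implication looks at other worlds. *)
Lemma canonical_forces (a : form Atm) (w : world canonical_model) :
  (a \in (sval w).1 -> forces w a) /\ (a \in (sval w).2 -> ~ forces w a).
Proof.
elim: a w => [p||a IHa b IHb|a IHa b IHb|a IHa b IHb] w;
  have sat := svalP w; split=> /=.
- by [].
- move=> pD pG; apply: (saturated_underivable _ _ _ sat).
  exact: LJpm_ax pG pD.
- by move=> botG; apply: (saturated_underivable _ _ _ sat); apply: LJpm_botL.
- by move=> _ [].
- by case/(saturated_orL sat clU) => [/(IHa w).1|/(IHb w).1]; [left|right].
- by case/(saturated_orR sat clU) => /(IHa w).2 na /(IHb w).2 nb [].
- by case/(saturated_andL sat clU) => /(IHa w).1 fa /(IHb w).1.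
- by case/(saturated_andR sat clU) => [/(IHa w).2|/(IHb w).2] nf [].
(* The implication persists to [v]; there [a] cannot lie in the succedent, being forced, so [b] lies
   in the antecedent. *)
- move=> abG v /fsubsetP vw fa.
  case: (saturated_impL (svalP v) clU _ _ (vw _ abG)) => [/(IHa v).2 //|].
  by move/(IHb v).1.
- case/(saturated_impR sat clU) => G' [D' [sat' GG' aG' bD']] fab.
  pose v : world canonical_model := exist _ (G', D') sat'.
  by apply: ((IHb v).2 bD'); exact: (fab v GG' ((IHa v).1 aG')).
Qed.

End CanonicalModel.

Lemma LJpm_complete (Atm : choiceType) (G D : {fset form Atm}) :
  int_valid G D -> LJpm G D.
Proof.
move=> validGD; apply: NNPP => nGD.
have [U clU] := subform_closed_cover _ (G `|` D).
rewrite fsubUset => /andP[GU DU].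
have [G' [D' [sat /fsubsetP GG' /fsubsetP DD']]] :=
  saturated_extension GU DU nGD.
pose w : world (canonical_model sat) := exist _ (G', D') sat.
have [a aG|a /DD' aD fa] := validGD _ w.
  by apply: (canonical_forces clU sat a w).1; apply: GG'.
exact: (canonical_forces clU sat a w).2 aD fa.
Qed.

(** * Soundness and cut *)

Lemma forces_mono (Atm : choiceType) (M : kripke_model Atm) (s t : world M)
    (a : form Atm) :
  acc s t -> forces s a -> forces t a.
Proof.
move=> st; elim: a => [p||a IHa b IHb|a IHa b IHb|a IHa b IHb] //=.
- exact: val_mono.
- by case=> [/IHa|/IHb]; [left|right].
- by case=> /IHa fa /IHb.
- by move=> fab u tu; apply: fab; apply: acc_trans tu.
Qed.

Lemma forces_conjU1 (Atm : choiceType) (M : kripke_model Atm) (s : world M)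
    (G : {fset form Atm}) (a : form Atm) :
  forces s a -> forces_conj s G -> forces_conj s (a |` G).
Proof. by move=> fa fG b; rewrite !inE => /orP[/eqP->|/fG]. Qed.

Lemma forces_disjU1 (Atm : choiceType) (M : kripke_model Atm) (s : world M)
    (D : {fset form Atm}) (a : form Atm) :
  forces_disj s (a |` D) -> forces s a \/ forces_disj s D.
Proof.
case=> b; rewrite !inE => /orP[/eqP->|bD] fb; first by left.
by right; exists b.
Qed.

Lemma LJpm_sound (Atm : choiceType) (G D : {fset form Atm}) :
  LJpm G D -> int_valid G D.
Proof.
elim=> {G D} [G D p pG pD|G D botG|G D a b abG _ IHa _ IHb|D G a b abG _ IH
  |G D a b abG _ IH|D G a b abG _ IHa _ IHb|G D a b abG _ IHa _ IHb
  |D G a b abG _ IH] M s fs.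
- by exists (Atom p) => //; apply: fs.
- by case: (fs _ botG).
- by case: (fs _ abG) => f; [apply: IHa|apply: IHb]; apply: forces_conjU1.
- case/forces_disjU1: (IH M s fs) => [fa|/forces_disjU1[fb|//]].
    by exists (Or a b) => //; left.
  by exists (Or a b) => //; right.
- by case: (fs _ abG) => fa fb; apply: IH; do 2!apply: forces_conjU1 => //.
- case/forces_disjU1: (IHa M s fs) => // fa.
  by case/forces_disjU1: (IHb M s fs) => // fb; exists (And a b).
(* Reflexivity lets the forced implication be used at [s] itself. *)
- case/forces_disjU1: (IHa M s fs) => // fa; apply: IHb.
  by apply: forces_conjU1 => //; apply: (fs _ abG) fa; apply: acc_refl.
(* Persistence carries the antecedent to [t]; the one-formula succedent of the premise then forces
   [b] there. *)
- exists (Imp a b) => // t st fa.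
  have [|c] := IH M t; last by rewrite inE => /eqP->.
  by apply: forces_conjU1 => // c /fs; apply: forces_mono.
Qed.

Theorem theorem1p5 (Atm : choiceType) :
  (forall G D : {fset form Atm}, int_valid G D -> LJpm G D) /\
  (forall (G D : {fset form Atm}) (a : form Atm),
      LJpm G (a |` D) -> LJpm (a |` G) D -> LJpm G D).
Proof.
split=> [|G D a /LJpm_sound validR /LJpm_sound validL]; first exact: LJpm_complete.
apply: LJpm_complete => M s fs.
case/forces_disjU1: (validR M s fs) => // fa.
by apply: validL; apply: forces_conjU1.
Qed.
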